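(* There is an absolute constant $K$ such that for every non-trivial word $w\in F_2$, $$D_{F_2}(w)\leq \frac25|w|+K.$$ Equivalently, there is an absolute constant $K'$ such that for every positive integer $n$, $$\alpha(n)\geq \frac52 n-K'.$$
   Context: $F_2=\langle a,b\rangle$ is the free group on two generators, whose elements are considered as reduced words over the alphabet $\{a,a^{-1},b,b^{-1}\}$; $|w|$ denotes the length of the reduced word $w$. For $1\neq w\in F_2$, the divisibility index is $$D_{F_2}(w):=\min\{[F_2:H] : H\leq F_2,\ w\notin H\}.$$ A non-trivial word $w\in F_2$ is a law for a group $G$ if $w(g,h)=1$ for every $g,h\in G$ (where $w(g,h)$ is the result of substituting $a\mapsto g$, $b\mapsto h$). For a positive integer $n$, $$\alpha(n):=\min\{|w| : w \text{ is a law for the symmetric group } S_n\},$$ i.e. the length of the shortest non-trivial two-variable law for $S_n$. *)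

(* Defs.v *)
From HB Require Import structures.
From mathcomp Require Import all_boot all_fingroup. 
From mathcomp Require Import cyclic.
From mathcomp Require Import boolp classical_sets functions cardinality.

Set Implicit Arguments.
Unset Strict Implicit.
Unset Printing Implicit Defensive.

Local Open Scope classical_set_scope.
Local Open Scope card_scope.

(* [(x, e)] encodes a generator, [a] if [x = false] and [b] if [x = true],
   inverted iff [e = true]. *)
Definition letter : Type := (bool * bool)%type.

Definition inv_letter (l : letter) : letter := (l.1, ~~ l.2).

Definition reduced : pred (seq letter) :=
  sorted (fun l m : letter => m != inv_letter l).

Definition push (l : letter) (s : seq letter) : seq letter :=
  if s is m :: s' then if m == inv_letter l then s' else l :: s else [:: l].

Definition reduce (s : seq letter) : seq letter := foldr push [::] s.

Definition inv_word (s : seq letter) : seq letter := rev (map inv_letter s).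

Lemma inv_letterK : involutive inv_letter.
Proof. by case=> x e; rewrite /inv_letter /= negbK. Qed.

Lemma eq_inv_letter l m : (m == inv_letter l) = (l == inv_letter m).
Proof. by rewrite -(inj_eq (can_inj inv_letterK)) inv_letterK eq_sym. Qed.

Lemma reduced_cons l s :
  reduced (l :: s) = (if s is m :: _ then m != inv_letter l else true) && reduced s.
Proof. by case: s. Qed.

Lemma reduced_behead l s : reduced (l :: s) -> reduced s.
Proof. by rewrite reduced_cons => /andP[]. Qed.

Lemma reduced_push l s : reduced s -> reduced (push l s).
Proof.
case: s => [|m s] //= rs; case: ifPn => [_|ml]; first exact: reduced_behead rs.
by rewrite reduced_cons ml.
Qed.

Lemma pushK l s : reduced s -> push (inv_letter l) (push l s) = s.
Proof.
case: s => [|m s] rs; rewrite /= ?inv_letterK ?eqxx //.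
case: eqP => [ml|_]; last by rewrite /= inv_letterK eqxx.
case: s rs => [|k s]; rewrite ?ml //= => /andP[km _].
by rewrite ifN.
Qed.

Lemma reduced_foldr s t : reduced t -> reduced (foldr push t s).
Proof. by move=> rt; elim: s => //= l s; apply: reduced_push. Qed.

Lemma reduced_reduce s : reduced (reduce s).
Proof. exact: reduced_foldr. Qed.

Lemma reduce_id s : reduced s -> reduce s = s.
Proof.
elim: s => //= l s IH rls; rewrite (IH (reduced_behead rls)).
by case: s rls {IH} => //= m s /andP[ml _]; rewrite ifN.
Qed.

Lemma foldr_push_reduce s t :
  reduced t -> foldr push t (reduce s) = foldr push t s.
Proof.
move=> rt; elim: s => //= l s <-.
have : reduced (reduce s) by exact: reduced_reduce.
case: (reduce s) => //= m u rmu; case: eqP => //= ->.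
rewrite -{1}[l]inv_letterK pushK //; exact: reduced_foldr.
Qed.

Lemma reduce_catl s t : reduce (reduce s ++ t) = reduce (s ++ t).
Proof.
rewrite /reduce !foldr_cat -/(reduce s) foldr_push_reduce //.
exact: reduced_reduce.
Qed.

Lemma reduce_catr s t : reduce (s ++ reduce t) = reduce (s ++ t).
Proof.
rewrite [LHS]foldr_cat [RHS]foldr_cat -!/(reduce _).
by rewrite (reduce_id (reduced_reduce t)).
Qed.

Lemma reduced_inv_word s : reduced s -> reduced (inv_word s).
Proof.
rewrite /reduced /inv_word rev_sorted sorted_map.
apply: sub_sorted => l m /=; rewrite inv_letterK eq_sym.
by apply: contraNN => /eqP ->.
Qed.

Lemma inv_wordK : involutive inv_word.
Proof.
move=> s; rewrite /inv_word map_rev revK -map_comp.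
by rewrite (eq_map (_ : _ =1 id)) ?map_id // => l /=; apply: inv_letterK.
Qed.

Lemma reduce_inv_word s : reduce (inv_word s ++ s) = [::].
Proof.
elim: s => //= l s IH; rewrite /inv_word map_cons rev_cons cat_rcons.
rewrite -reduce_catr /= -/(reduce s) pushK ?reduced_reduce //.
by rewrite reduce_catr.
Qed.

Record F2 : Type := MkF2 { word : seq letter; word_reduced : reduced word }.

HB.instance Definition _ := [isSub for word].
HB.instance Definition _ := [Choice of F2 by <:].

Definition F2_one : F2 := @MkF2 [::] isT.
Definition F2_inv (u : F2) : F2 := MkF2 (reduced_inv_word (word_reduced u)).
Definition F2_mul (u v : F2) : F2 := MkF2 (reduced_reduce (word u ++ word v)).

Lemma F2_mulA : associative F2_mul.
Proof. by move=> u v w; apply: val_inj; rewrite /= reduce_catl reduce_catr catA. Qed.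

Lemma F2_mul1 : left_id F2_one F2_mul.
Proof. by move=> u; apply: val_inj; rewrite /= reduce_id ?word_reduced. Qed.

Lemma F2_mulr1 : right_id F2_one F2_mul.
Proof. by move=> u; apply: val_inj; rewrite /= cats0 reduce_id ?word_reduced. Qed.

Lemma F2_mulV : left_inverse F2_one F2_inv F2_mul.
Proof. by move=> u; apply: val_inj; rewrite /= reduce_inv_word. Qed.

Lemma F2_mulrV : right_inverse F2_one F2_inv F2_mul.
Proof.
move=> u; apply: val_inj => /=.
by rewrite -{1}[word u]inv_wordK reduce_inv_word.
Qed.

HB.instance Definition _ :=
  isGroup.Build F2 F2_mulA F2_mul1 F2_mulr1 F2_mulV F2_mulrV.

Definition word_length (w : F2) : nat := size (word w).

Definition eval_letter (G : groupType) (g h : G) (l : letter) : G :=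
  let x := if l.1 then h else g in if l.2 then (x^-1)%g else x.

Definition eval (G : groupType) (g h : G) (w : F2) : G :=
  (\prod_(l <- word w) eval_letter g h l)%g.

Definition is_law (G : groupType) (w : F2) : Prop :=
  w <> 1%g /\ forall g h : G, eval g h w = 1%g.

Definition left_cosets (G : groupType) (H : set G) : set (set G) :=
  range (fun x : G => [set (x * h)%g | h in H]).

(* [G : H] = n; no n satisfies this when the index is infinite. *)
Definition has_index (G : groupType) (H : set G) (n : nat) : Prop :=
  left_cosets H #= `I_n.

Lemma asbool_nonempty (P : set nat) : P !=set0 -> exists n, `[< P n >].
Proof. by case=> n Pn; exists n; apply/asboolP. Qed.

Definition nat_min (P : set nat) (P0 : P !=set0) : nat :=
  ex_minn (asbool_nonempty P0).

Lemma nat_minP (P : set nat) (P0 : P !=set0) :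
  P (nat_min P0) /\ forall n, P n -> (nat_min P0 <= n)%N.
Proof.
rewrite /nat_min; case: ex_minnP => m /asboolP Pm mP; split=> // n Pn.
by apply: mP; apply/asboolP.
Qed.

Definition separating_indices (w : F2) : set nat :=
  [set n | exists H : set F2, [/\ group_closed [in H], ~ H w & has_index H n]].

(* Residual finiteness of F2: an action of F2 on the reduced words of length at
   most n for which w . [::] = w whenever |w| <= n. *)
Section BoundedAction.
Variable n : nat.

Definition flip (x : bool) (l : letter) : letter :=
  if l.1 == x then inv_letter l else l.

Definition bpush (l : letter) (s : seq letter) : seq letter :=
  if (size s < n)%N || (ohead s == Some (inv_letter l)) then push l s
  else map (flip l.1) s.

Definition bounded : pred (seq letter) :=
  fun s => reduced s && (size s <= n)%N.

Lemma flipK x : involutive (flip x).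
Proof.
by move=> l; rewrite /flip; case lx: (l.1 == x); rewrite /= lx ?inv_letterK.
Qed.

Lemma flip_inv x l : flip x (inv_letter l) = inv_letter (flip x l).
Proof. by rewrite /flip /=; case: ifP. Qed.

Lemma reduced_flip x s : reduced s -> reduced (map (flip x) s).
Proof.
rewrite /reduced sorted_map; apply: sub_sorted => l m /=.
by rewrite -flip_inv (inj_eq (can_inj (flipK x))).
Qed.

Lemma bounded_bpush l s : bounded s -> bounded (bpush l s).
Proof.
move=> /andP[rs ns]; rewrite /bpush; case: ifPn => [c|_]; last first.
  by rewrite /bounded reduced_flip // size_map.
rewrite /bounded reduced_push //=; case: s c rs ns => [|m s] /=.
  by rewrite orbF.
case: (m =P inv_letter l) => [_ _ _|ml]; first exact: ltnW.
by case/orP => // /eqP[] /ml.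
Qed.

Lemma bpushK l s : bounded s -> bpush (inv_letter l) (bpush l s) = s.
Proof.
move=> /andP[rs ns]; rewrite {2}/bpush; case: ifPn => [c|].
  rewrite /bpush pushK //; case: ifP => //.
  case: s c rs ns => [|m s] /=; first by rewrite inv_letterK eqxx orbT.
  case: (m =P inv_letter l) => [_ _ _ ->//|ml _ _ _ /=].
  by rewrite inv_letterK eqxx orbT.
rewrite negb_or -leqNgt => /andP[sn hs].
rewrite /bpush size_map ltnNge sn /= inv_letterK.
have -> : (ohead (map (flip l.1) s) == Some l) = false.
  case: s hs {rs ns sn} => //= m s hm; apply/negbTE; apply: contraNN hm.
  move=> /eqP[lm]; apply/eqP; congr Some.
  by rewrite -[m](flipK l.1) lm /flip eqxx.
by rewrite -map_comp (eq_map (_ : _ =1 id)) ?map_id // => m /=; apply: flipK.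
Qed.

Definition bact (u s : seq letter) : seq letter := foldr bpush s u.

Lemma bounded_bact u s : bounded s -> bounded (bact u s).
Proof. by move=> bs; elim: u => //= l u; apply: bounded_bpush. Qed.

Lemma bact_reduce u s : bounded s -> bact (reduce u) s = bact u s.
Proof.
move=> bs; elim: u => //= l u <-.
case: (reduce u) => //= m v; case: eqP => //= ->.
by rewrite -{1}[l]inv_letterK bpushK //; apply: bounded_bact.
Qed.

Lemma bact_nil u : bounded u -> bact u [::] = u.
Proof.
elim: u => //= l u IH /andP[rlu lun].
rewrite IH; last by rewrite /bounded (reduced_behead rlu) ltnW.
rewrite /bpush lun /=.
by case: u rlu {IH lun} => //= m u /andP[ml _]; rewrite ifN.
Qed.

Definition stab : set F2 := [set x | bact (word x) [::] = [::]].

Lemma bounded0 : bounded [::]. Proof. by []. Qed.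

Lemma bactM (x y : F2) s :
  bounded s -> bact (word (x * y)%g) s = bact (word x) (bact (word y) s).
Proof. by move=> bs; rewrite bact_reduce // /bact foldr_cat. Qed.

Lemma bactKV (x : F2) s :
  bounded s -> bact (word (x^-1)%g) (bact (word x) s) = s.
Proof. by move=> bs; rewrite -bactM // mulVg. Qed.

Lemma group_closed_stab : group_closed [in stab].
Proof.
split=> [|x y]; rewrite !in_setE // => hx hy.
change (bact (word (x * y^-1)%g) [::] = [::]).
by rewrite bactM // -{1}hy bactKV.
Qed.

Lemma finite_left_cosets_stab : finite_set (left_cosets stab).
Proof.
pose f (s : seq letter) : set F2 := [set x | bact (word x) [::] = s].
pose B : set (seq letter) := range (fun t : {bseq n of letter} => val t).
have finB : finite_set B by apply: finite_image; apply: finite_finset.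
apply: sub_finite_set (finite_image f finB) => _ [x _ <-].
have /andP[_ bx] := bounded_bact (word x) bounded0.
exists (bact (word x) [::]); first by exists (Bseq bx).
rewrite /f; apply/seteqP; split=> y /=; last first.
  move=> [h hh <-].
  change (bact (word (x * h)%g) [::] = bact (word x) [::]).
  by rewrite bactM // hh.
move=> yx; exists (x^-1 * y)%g; last by rewrite mulgA mulgV mul1g.
change (bact (word (x^-1 * y)%g) [::] = [::]); by rewrite bactM // yx bactKV.
Qed.

End BoundedAction.

Lemma separating_indices_nonempty (w : F2) :
  w <> 1%g -> separating_indices w !=set0.
Proof.
move=> w1; have [k hk] := finite_left_cosets_stab (word_length w).
exists k, (stab (word_length w)); split=> //; first exact: group_closed_stab.
rewrite /stab /= bact_nil ?/bounded ?word_reduced ?leqnn // => w0.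
by apply: w1; apply: val_inj.
Qed.

Definition divisibility_index (w : F2) (w1 : w <> 1%g) : nat :=
  nat_min (separating_indices_nonempty w1).

Definition law_lengths (n : nat) : set nat :=
  [set word_length w | w in [set w : F2 | is_law 'S_n w]].

(* The law is a ^ n!. *)
Lemma law_lengths_nonempty (n : nat) : law_lengths n !=set0.
Proof.
have red k : reduced (nseq k (false, false)).
  elim: k => // k IH.
  by rewrite -[nseq k.+1 _]/(_ :: nseq k _) reduced_cons IH andbT; case: k {IH}.
pose w := MkF2 (red #|[set: 'S_n]%SET|).
exists (word_length w); exists w => //; split.
  move=> /(congr1 word_length); rewrite /word_length size_nseq /= => S0.
  by have := cardG_gt0 [set: 'S_n]%G; rewrite /= S0.
move=> g h; rewrite /eval /= big_nseq.
have iterE k :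
    iter k (fun x : 'S_n => (eval_letter g h (false, false) * x)%g) 1%g =
    (g ^+ k)%g.
  by elim: k => //= k ->; rewrite expgS.
by rewrite iterE (@expg_cardG _ [set: 'S_n]%G) ?inE.
Qed.

Definition alpha (n : nat) : nat := nat_min (law_lengths_nonempty n).

(* Main.v *)
Require Import Defs.
From mathcomp Require Import all_boot all_order all_algebra all_fingroup.
From mathcomp Require Import boolp classical_sets functions cardinality reals.
From mathcomp Require Import zify lra.

(** Why the theorem holds.

    Let A and B be the numbers of letters a^{+-1} and b^{+-1} in the reduced
    word w; up to exchanging a and b, B <= A.  Let permutations a, b of a
    finite set V be given, and follow the path of w from some point.  If some
    b-edge is traversed exactly once by this path, then w is nontrivial in a
    symmetric group on at most |V| + 1 points: either the path is not closed,
    or a new point can be inserted in the middle of that edge, and the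
    cyclic rotation of w that starts just after the edge now runs back to the
    edge as before and ends at the new point
    (nontrivial_of_single_edge).

    Since the path has only B b-edges, counted with multiplicity, a b-edge
    traversed exactly once must exist as soon as more than B/2 distinct b-edges
    are traversed.  So it is enough to take a segment of w that contains
    h + 1 letters b^{+-1}, where h = floor(B/2), and to choose a and b on a
    small set such that this segment traverses h + 1 distinct b-edges.

    Two consecutive b-letters of the segment are separated by a power a^i, a
    link.  A link enters V at a point u and leaves it at the point u' which a^i
    sends u to; it occupies one end of a b-edge at u and one at u'.  The
    b-edges may join the links in any way, so the only constraint is that the
    ends occupied by different links, or by the two sides of one link, be
    different: placing the links is a packing problem, in which the order of
    the links is irrelevant (packed, packable).  If the b-letters
    around the link have the same sign, then one fixed point of a is
    enough.  If the signs differ, then u and u' must differ.  Sign changes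
    alternate between two kinds, which occupy the sources and the targets of
    b-edges respectively, so one link a^i of the first kind and one link a^j of
    the second can share a single cycle of a, of length D, if D divides neither
    i nor j; and D can be chosen at most (|i| + |j|)/2 + 2.  Hence a link a^i
    costs on average at most 1 + |i|/2 points.

    There are two segments to choose from, the first and the last h + 1
    b-letters.  Together their links cover w once, except that for even B the
    middle link belongs to both; that link is given a cycle of its own, whose
    length is only about |i|/4.  The cheaper of the two segments then needs at
    most (2B + A)/4 + O(1) points, which is at most (2/5)(A + B) + O(1) because
    B <= A.  The case B = 0 is a single cycle of a. *)

Set Implicit Arguments.
Unset Strict Implicit.
Unset Printing Implicit Defensive.

Local Open Scope group_scope.

(** * Words as products and as paths *)

(** The value of an arbitrary list of letters: segments and rotations of w need
    not be reduced, and eval only applies to F2. *)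
Definition ev (G : groupType) (g h : G) (s : seq letter) : G :=
  \prod_(l <- s) eval_letter g h l.

Section Evaluation.
Variables (G : groupType) (g h : G).

Lemma ev_nil : ev g h [::] = 1.
Proof. exact: big_nil. Qed.

Lemma ev_cons l s : ev g h (l :: s) = eval_letter g h l * ev g h s.
Proof. exact: big_cons. Qed.

Lemma ev_cat s t : ev g h (s ++ t) = ev g h s * ev g h t.
Proof. exact: big_cat. Qed.

Lemma eval_letter_inv l : eval_letter g h (inv_letter l) = (eval_letter g h l)^-1.
Proof. by case: l => x [] //=; rewrite /eval_letter /= invgK. Qed.

Lemma ev_reduce s : ev g h (reduce s) = ev g h s.
Proof.
elim: s => //= l s IH; rewrite ev_cons -IH.
case: (reduce s) => [|m t] /=; first by rewrite ev_cons.
case: eqP => [->|_]; last by rewrite ev_cons.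
by rewrite ev_cons eval_letter_inv mulKVg.
Qed.

Lemma eval1 : eval g h 1 = 1.
Proof. exact: ev_nil. Qed.

Lemma evalM (x y : F2) : eval g h (x * y) = eval g h x * eval g h y.
Proof. by rewrite -[LHS]/(ev g h (reduce _)) ev_reduce ev_cat. Qed.

Lemma evalV (x : F2) : eval g h x^-1 = (eval g h x)^-1.
Proof. by apply: (mulgI (eval g h x)); rewrite -evalM !mulgV eval1. Qed.

Lemma ev_run e n :
  ev g h (nseq n (false, e)) = (if e then g^-1 else g) ^+ n.
Proof.
elim: n => [|n IH]; first by rewrite ev_nil.
by rewrite -[nseq _ _]/((false, e) :: nseq n _) ev_cons IH expgS.
Qed.

End Evaluation.

Definition swap_letter (l : letter) : letter := (~~ l.1, l.2).

Lemma ev_swap (G : groupType) (g h : G) s :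
  ev g h (map swap_letter s) = ev h g s.
Proof.
rewrite /ev big_map; apply: eq_bigr => -[x e] _.
by rewrite /eval_letter /=; case: x.
Qed.

Section Walk.
Variables (V : finType) (a b : {perm V}).

Definition step (l : letter) (p : V) : V := (eval_letter a b l : {perm V}) p.

Definition walk (s : seq letter) (p : V) : V := foldl (fun q l => step l q) p s.

Lemma walkE s p : walk s p = (ev a b s : {perm V}) p.
Proof.
elim: s p => [|l s IH] p; first by rewrite ev_nil perm1.
by rewrite /= -/(walk s _) IH ev_cons permM.
Qed.

Lemma walk_cat s t p : walk (s ++ t) p = walk t (walk s p).
Proof. exact: foldl_cat. Qed.

Lemma ev_walk1 s : ev a b s = 1 <-> forall p, walk s p = p.
Proof.
split=> [s1 p|s1]; first by rewrite walkE s1 perm1.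
by apply/permP => p; rewrite -walkE s1 perm1.
Qed.

(** A b-edge is named by its source, whether it is traversed forwards or
    backwards; this lists the b-edges of the path from p in order. *)
Fixpoint tails (p : V) (s : seq letter) : seq V :=
  if s is l :: s' then
    if l.1 then (if l.2 then step l p else p) :: tails (step l p) s'
    else tails (step l p) s'
  else [::].

Lemma tails_cat p s t : tails p (s ++ t) = tails p s ++ tails (walk s p) t.
Proof. by elim: s p => //= l s IH p; rewrite IH; case: l.1. Qed.

Lemma size_tails p s : size (tails p s) = count (fun l => l.1) s.
Proof. by elim: s p => //= l s IH p; case: l.1; rewrite /= IH. Qed.

Lemma tails_run p e n : tails p (nseq n (false, e)) = [::].
Proof. by elim: n p => //= n IH p; apply: IH. Qed.

(** Cuts the path at a b-edge which it traverses exactly once. *)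
Lemma tails_split x p s : count_mem x (tails p s) = 1%N ->
  exists u l v, [/\ s = u ++ l :: v, l.1,
    x = (if l.2 then step l (walk u p) else walk u p),
    x \notin tails p u & x \notin tails (step l (walk u p)) v].
Proof.
elim: s p => //= l s IH p.
have later : count_mem x (tails (step l p) s) = 1%N ->
    (l.1 -> (if l.2 then step l p else p) != x) ->
    exists u m v, [/\ l :: s = u ++ m :: v, m.1,
    x = (if m.2 then step m (walk u p) else walk u p),
    x \notin tails p u & x \notin tails (step m (walk u p)) v].
  move=> /IH[u [m [v [-> m1 xE xu xv]]]] lx.
  exists (l :: u), m, v; split=> //=.
  by case: ifP xu => // l1 xu; rewrite inE negb_or eq_sym lx.
case: ifP => [l1|l1] /=; last by move=> c; apply: later; rewrite ?l1.
case: eqP => [xE|xE]; last by move=> c; apply: later => // _; apply/eqP.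
rewrite add1n => -[c0]; exists [::], l, s; split=> //=.
by rewrite -has_pred1 has_count c0.
Qed.

End Walk.

(** An equivariant map carries paths to paths. This serves for placing
    permutations side by side, and for adding fixed points. *)
Lemma walk_intertwine (V W : finType) (a b : {perm V}) (a' b' : {perm W})
    (f : V -> W) :
  (forall v, a' (f v) = f (a v)) -> (forall v, b' (f v) = f (b v)) ->
  forall s v, walk a' b' s (f v) = f (walk a b s v).
Proof.
move=> fa fb; elim=> [|[x e] s IH] v //=; rewrite -!/(walk _ _ s _) -IH.
congr (walk _ _ _ _).
have aux (c : {perm V}) (c' : {perm W}) :
    (forall v, c' (f v) = f (c v)) ->
    (if e then c'^-1 else c') (f v) = f ((if e then c^-1 else c) v).
  move=> fc; case: e => //; apply: (perm_inj (s := c')).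
  by rewrite permKV fc permKV.
by rewrite /step /eval_letter /=; case: x; apply: aux.
Qed.

(** * An edge traversed exactly once makes a word nontrivial *)

(** If every element of s occurred at least twice in s, then s would have at
    least twice as many entries as t. *)
Lemma count_mem1_exists (T : eqType) (s t : seq T) :
  uniq t -> {subset t <= s} -> size s < (size t).*2 ->
  exists x, count_mem x s = 1%N.
Proof.
move=> ut ts sz; apply: contrapT => nx.
have ge2 x : x \in t -> 1 < count_mem x s.
  move=> /ts xs; have: 0 < count_mem x s by rewrite -has_count has_pred1.
  by rewrite leq_eqVlt => /orP[/eqP c1|//]; case: nx; exists x.
suff : (size t).*2 <= size s by rewrite leqNgt sz.
elim: t s ut ge2 {ts sz nx} => // x t IH s /= /andP[xt ut] ge2.
have := IH (filter (predC1 x) s) ut; rewrite size_filter => IHs.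
rewrite -(count_predC (pred1 x) s) doubleS -addn2 addnC.
apply: leq_add; first by apply: ge2; rewrite mem_head.
apply: IHs => y yt; rewrite count_filter.
rewrite (eq_count (a2 := pred1 y)); first by apply: ge2; rewrite inE yt orbT.
by move=> z /=; case: (z =P y) => //= ->; apply: contraNneq xt => <-.
Qed.

Section Insert.
Variables (V : finType) (a b : {perm V}) (x : V).

Definition lift_none (y : option V) : option V := omap a y.

Lemma lift_none_inj : injective lift_none.
Proof. by move=> [y|] [z|] //= [/perm_inj ->]. Qed.

(** The new point None is put on the b-edge from x to b x. *)
Definition insert_none (y : option V) : option V :=
  if y is Some z then if z == x then None else Some (b z) else Some (b x).

Lemma insert_none_inj : injective insert_none.
Proof.
move=> [y|] [z|] //=.
- case: eqP => [->|yx]; case: eqP => [->|zx] //.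
  by move=> [/perm_inj ->].
- by case: eqP => // yx [/perm_inj].
- by case: eqP => // yx [/perm_inj /esym].
Qed.

Lemma walk_insert s p : x \notin tails a b p s ->
  walk (perm lift_none_inj) (perm insert_none_inj) s (Some p) =
  Some (walk a b s p).
Proof.
elim: s p => [|[y e] s IH] p //=; rewrite -!/(walk _ _ s _) => xs.
have [-> xs'] : step (perm lift_none_inj) (perm insert_none_inj)
    (y, e) (Some p) = Some (step a b (y, e) p) /\
    x \notin tails a b (step a b (y, e) p) s.
  case: y xs => /=; last first.
    move=> xs; split=> //; rewrite /step /eval_letter /=; case: e {xs}.
      by apply: (perm_inj (s := perm lift_none_inj)); rewrite permKV permE /= permKV.
    by rewrite permE.
  rewrite inE negb_or => /andP[xp xs]; split=> //.
  rewrite /step /eval_letter /= in xp *; case: e xp {xs} => xp.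
    apply: (perm_inj (s := perm insert_none_inj)); rewrite permKV permE /=.
    by rewrite eq_sym (negPf xp) permKV.
  by rewrite permE /= eq_sym (negPf xp).
exact: IH.
Qed.

End Insert.

(** With w = u l v, l the letter that traverses the edge x: if w closes up at p,
    then the rotation v u l, started just after the edge, does not meet the
    edge before its last letter, so after the insertion it ends at the new
    point.  It is conjugate to w. *)
Lemma nontrivial_of_single_edge (V : finType) (a b : {perm V}) p s x :
  count_mem x (tails a b p s) = 1%N ->
  exists (W : finType) (a' b' : {perm W}),
    #|W| <= #|V|.+1 /\ ev a' b' s <> 1.
Proof.
move=> /tails_split[u [l [v [sE l1 xE xu xv]]]].
have [sp|sp] := eqVneq (walk a b s p) p; last first.
  by exists V, a, b; split=> // /ev_walk1/(_ p)/eqP; apply/negP.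
set a' := perm (lift_none_inj (a := a)).
set b' := perm (insert_none_inj (b := b) (x := x)).
exists (option V), a', b'; rewrite card_option; split=> // s1.
set q := step a b l (walk a b u p) in xE xv.
have vq : walk a b v q = p by rewrite -[RHS]sp sE walk_cat.
have : ev a' b' (v ++ u ++ [:: l]) = 1.
  have uE : ev a' b' (u ++ [:: l]) * ev a' b' v = 1.
    by rewrite -ev_cat -catA -sE.
  by rewrite ev_cat -[ev a' b' v](mulKg (ev a' b' (u ++ [:: l]))) uE mulg1 mulVg.
move=> /ev_walk1/(_ (Some q)); rewrite !walk_cat walk_insert // vq.
rewrite walk_insert //= /step; move: xE; rewrite /q.
case: l l1 @q {sE xv vq} => [[] // e] _ _; rewrite /step /eval_letter /=.
case: e => xE.
  suff -> : b'^-1 (Some (walk a b u p)) = None by [].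
  by apply: (perm_inj (s := b')); rewrite permKV permE /= xE permKV.
by rewrite permE /= -xE eqxx.
Qed.

(** Adding the pair (x, y) costs one transposition: b followed by the exchange of
    b x and y still takes the prescribed value at the other points, because
    those values differ from both b x and y. *)
Lemma extend_partial_injection (V : finType) (s : seq (V * V)) :
  uniq (unzip1 s) -> uniq (unzip2 s) ->
  exists b : {perm V}, forall e, e \in s -> b e.1 = e.2.
Proof.
elim: s => [|[x y] s IH] /=; first by exists 1.
move=> /andP[xs u1] /andP[ys u2]; have [b bE] := IH u1 u2.
exists (b * tperm (b x) y) => e; rewrite inE permM => /predU1P[->|es] /=.
  by rewrite tpermL.
rewrite -(bE e es) tpermD //.
  by rewrite (inj_eq perm_inj); apply: contraNneq xs => ->; apply: map_f.
by rewrite (bE e es); apply: contraNneq ys => ->; apply: map_f.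
Qed.

(** * Packing the links *)

(** The pair (e, n) stands for the power a^n, or a^{-n} if e holds. *)
Definition run (V : finType) (a : {perm V}) (r : bool * nat) : {perm V} :=
  (if r.1 then a^-1 else a) ^+ r.2.

Lemma walk_run (V : finType) (a b : {perm V}) e n p :
  walk a b (nseq n (false, e)) p = run a (e, n) p.
Proof. by rewrite walkE ev_run. Qed.

Lemma run_intertwine (V W : finType) (a : {perm V}) (c : {perm W})
    (f : V -> W) r :
  (forall v, c (f v) = f (a v)) -> forall v, run c r (f v) = f (run a r v).
Proof.
move=> fc v; case: r => e n.
by rewrite -(walk_run a a) -(walk_run c c); apply: walk_intertwine.
Qed.

Definition rotation (D : nat) : {perm 'I_D.+1} := perm (can_inj (@ordSK D.+1)).

Lemma run_rotation_fix D e n :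
  (run (rotation D) (e, n) ord0 == ord0) = (D.+1 %| n).
Proof.
have rotE m : val ((rotation D ^+ m) ord0) = m %% D.+1.
  elim: m => [|m IH]; first by rewrite perm1 mod0n.
  by rewrite expgSr permM permE /= IH -addn1 modnDml addn1.
transitivity ((rotation D ^+ n) ord0 == ord0).
  case: e; rewrite /run //= expgVn.
  by rewrite -(inj_eq (perm_inj (s := rotation D ^+ n))) permKV eq_sym.
by rewrite -val_eqE rotE.
Qed.

(** For 1 <= m <= n: n + 1 divides neither, and is small enough if n <= m + 1.
    Otherwise take a number larger than m and strictly between n/2 and n. *)
Lemma rotation_size_pair m n : 0 < m -> 0 < n ->
  exists D, [/\ ~~ (D.+1 %| m), ~~ (D.+1 %| n) & 2 * D.+1 <= m + n + 4].
Proof.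
wlog mn : m n / m <= n => [wl m0 n0|m0 n0].
  have [mn|/ltnW nm] := leqP m n; first exact: wl.
  by have [D [? ? ?]] := wl n m nm n0 m0; exists D; split=> //; rewrite [m + n]addnC.
have gtn k d : 0 < k < d -> ~~ (d %| k).
  by move=> /andP[k0 kd]; rewrite gtnNdvd.
have [mn1|nm] := leqP n m.+1; first by exists n; split; [apply: gtn|apply: gtn|]; lia.
exists (maxn (n %/ 2) m); split; first by apply: gtn; lia.
  apply/dvdnP => -[q nE]; have q2 : q < 2 by nia.
  have q1 : 1 < q by nia.
  by rewrite ltnNge -ltnS q2 in q1.
by lia.
Qed.

(** A number strictly between n/4 and n/3 does not divide n, and n/4 + 1 is one
    if n > 12; the constant 40 leaves room for the length n + 1 otherwise. *)
Lemma rotation_size_single n : 0 < n ->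
  exists D, ~~ (D.+1 %| n) /\ 4 * D.+1 <= n + 40.
Proof.
move=> n0; have [n12|n13] := leqP n 12.
  by exists n; rewrite gtnNdvd //; lia.
exists (n %/ 4); split; last by lia.
by apply/dvdnP => -[[|[|[|[|q]]]] nE]; nia.
Qed.

Section Packing.
Variables (runs : nat -> bool * nat) (f : nat -> bool).

(** Link j is the power runs j of a; the Booleans f j and f j.+1 tell whether the
    b-letter before it and the b-letter after it are inverted.  An end of a
    b-edge is a point with a Boolean, true for the source of the edge.  The
    link enters at u j, which is the target of a b-edge if the letter before
    is b and the source if it is b^{-1}; at the exit it is the other way
    round. *)
Definition slot (V : finType) (a : {perm V}) (u : nat -> V) j (x : bool) :
    V * bool :=
  if x then (run a (runs j) (u j), ~~ f j.+1) else (u j, f j).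

Definition packed (V : finType) (a : {perm V}) (u : nat -> V) (s : seq nat) :=
  forall j j' x x', j \in s -> j' \in s ->
  slot a u j x = slot a u j' x' -> (j, x) = (j', x').

(** The factor 4 avoids fractions in the bounds. *)
Definition packable (s : seq nat) (c : nat) :=
  exists (V : finType) (a : {perm V}) (u : nat -> V),
    packed a u s /\ 4 * #|V| <= c.

Lemma packable_sub s t c c' :
  {subset t <= s} -> c <= c' -> packable s c -> packable t c'.
Proof.
move=> ts cc' [V [a [u [pu Vc]]]]; exists V, a, u; split; last exact: leq_trans cc'.
by move=> j j' x x' /ts js /ts j's; apply: pu.
Qed.

Lemma packable_nil : packable [::] 4.
Proof. by exists unit, 1, (fun _ => tt); rewrite card_unit. Qed.

(** Disjoint union of two configurations. *)
Lemma packable_cat s t c d :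
  packable s c -> packable t d -> packable (s ++ t) (c + d).
Proof.
move=> [V [a [u [pu Vc]]]] [W [a' [u' [pu' Wd]]]].
pose g (x : V + W) := match x with inl v => inl (a v) | inr w => inr (a' w) end.
have g_inj : injective g by move=> [v|v] [w|w] //= [/perm_inj ->].
pose U j : V + W := if j \in s then inl (u j) else inr (u' j).
have runl r v : run (perm g_inj) r (inl v) = inl (run a r v).
  by apply: run_intertwine => {}v; rewrite permE.
have runr r w : run (perm g_inj) r (inr w) = inr (run a' r w).
  by apply: run_intertwine => {}w; rewrite permE.
have slotE j x : slot (perm g_inj) U j x =
    if j \in s then (inl (slot a u j x).1, (slot a u j x).2)
    else (inr (slot a' u' j x).1, (slot a' u' j x).2).
  by rewrite /slot /U; case: x; case: (j \in s); rewrite ?runl ?runr.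
exists (V + W : finType)%type, (perm g_inj), U; split; last first.
  by rewrite card_sum mulnDr leq_add.
move=> j j' x x'; rewrite !mem_cat !slotE.
case: ifP => js; case: ifP => j's //= jt j't [e1 e2].
  by apply: pu => //; rewrite [LHS]surjective_pairing e1 e2 -surjective_pairing.
by apply: pu' => //; rewrite [LHS]surjective_pairing e1 e2 -surjective_pairing.
Qed.

(** One cycle of length D + 1, entered at 0. If f j = f j.+1 the two slots have
    different kinds, so that a fixed point (D = 0) will do. *)
Lemma packable1 j D : (f j != f j.+1 -> ~~ (D.+1 %| (runs j).2)) ->
  packable [:: j] (4 * D.+1).
Proof.
move=> fD; exists 'I_D.+1, (rotation D), (fun _ => ord0); rewrite card_ord.
split=> // i i' x x'; rewrite !inE => /eqP-> /eqP-> {i i'}.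
have neq : (ord0, f j) <> (run (rotation D) (runs j) ord0, ~~ f j.+1).
  case: (runs j) fD => e n /= fD [/esym/eqP]; rewrite run_rotation_fix => Dn fj.
  by move: fD; rewrite Dn fj; case: (f _) => /(_ isT).
by rewrite /slot; case: x; case: x' => // E; case: neq.
Qed.

(** All slots of i have the kind f i and all slots of j the kind f j, so the two
    links can use the same cycle. *)
Lemma packable2 i j D :
  f i != f i.+1 -> f j != f j.+1 -> f i != f j ->
  ~~ (D.+1 %| (runs i).2) -> ~~ (D.+1 %| (runs j).2) ->
  packable [:: i; j] (4 * D.+1).
Proof.
move=> fi fj fij Di Dj.
exists 'I_D.+1, (rotation D), (fun _ => ord0); rewrite card_ord; split=> //.
have kind k x : k \in [:: i; j] ->
    (slot (rotation D) (fun _ => ord0) k x).2 = f k.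
  rewrite !inE => /orP[]/eqP->; case: x => //=.
    by case: (f i) fi; case: (f _).
  by case: (f j) fj; case: (f _).
have moves k : k \in [:: i; j] -> run (rotation D) (runs k) ord0 <> ord0.
  move=> kij; have : ~~ (D.+1 %| (runs k).2).
    by move: kij; rewrite !inE => /orP[]/eqP->.
  by case: (runs k) => e n /=; rewrite -(run_rotation_fix D e) => /eqP.
move=> k k' x x' kij k'ij E.
have fE : f k = f k' by rewrite -(kind k x) // -(kind k' x') // E.
have kk' : k = k'.
  move: kij k'ij fE fij; rewrite !inE => /orP[]/eqP-> /orP[]/eqP-> // ->.
    by rewrite eqxx.
  by rewrite eqxx.
move: E; rewrite -{k' k'ij fE}kk' /slot; case: x; case: x' => // -[kE _].
  by case: (moves k kij).
by case: (moves k kij).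
Qed.

(** The two kinds of sign change; falls occupy only sources and rises only
    targets of b-edges. *)
Definition falls j := f j && ~~ f j.+1.
Definition rises j := ~~ f j && f j.+1.
Definition cost j := (2 * (runs j).2 + 4)%N.

Lemma packable_straight (s : seq nat) :
  {in s, forall j, f j = f j.+1} -> packable s (\sum_(j <- s) cost j + 4).
Proof.
elim: s => [|j s IH] fs; first by rewrite big_nil; apply: packable_nil.
rewrite big_cons -addnA -cat1s; apply: packable_cat; last first.
  by apply: IH => i si; apply: fs; rewrite inE si orbT.
apply: (@packable_sub [:: j] _ (4 * 1)) => //; first by rewrite /cost; lia.
by apply: packable1; rewrite -fs ?mem_head ?eqxx.
Qed.

(** Falls and rises are paired off; each unpaired link is given a cycle of its
    own, at an extra cost of 6. *)
Lemma packable_turns (s t : seq nat) :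
  {in s, forall j, falls j && (0 < (runs j).2)} ->
  {in t, forall j, rises j && (0 < (runs j).2)} ->
  packable (s ++ t) (\sum_(j <- s ++ t) cost j +
    6 * (size s - size t + (size t - size s)) + 4).
Proof.
have turn j : falls j || rises j -> f j != f j.+1.
  by rewrite /falls /rises; case: (f j); case: (f _).
(* The length is chosen as for a partner with exponent 1. *)
have alone j : falls j || rises j -> 0 < (runs j).2 ->
    packable [:: j] (cost j + 6).
  move=> fj j0; have [D [Dj _ Dle]] := rotation_size_pair j0 (ltn0Sn 0).
  apply: (packable_sub (s := [:: j]) _ _ (packable1 (D := D) _)) => //.
  by rewrite /cost; lia.
elim: s t => [|i s IH] t /=.
  elim: t => [|j t IH] _ tr; first by rewrite big_nil; apply: packable_nil.
  have /andP[jr j0] := tr j (mem_head _ _).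
  have trt : {in t, forall j, rises j && (0 < (runs j).2)}.
    by move=> k kt; apply: tr; rewrite inE kt orbT.
  rewrite -cat1s; apply: packable_sub (packable_cat (alone _ _ j0) (IH _ trt)) => //.
    by rewrite big_cons /=; lia.
  by rewrite jr orbT.
move=> sf tr; have /andP[ifall i0] := sf i (mem_head _ _).
have sfs : {in s, forall j, falls j && (0 < (runs j).2)}.
  by move=> k ks; apply: sf; rewrite inE ks orbT.
case: t tr => [|j t] tr.
  apply: (packable_sub _ _ (packable_cat (alone _ _ i0) (IH [::] sfs _))) => //.
    by rewrite big_cons /=; lia.
  by rewrite ifall.
have /andP[jr j0] := tr j (mem_head _ _).
have trt : {in t, forall j, rises j && (0 < (runs j).2)}.
  by move=> k kt; apply: tr; rewrite inE kt orbT.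
have [D [Di Dj Dle]] := rotation_size_pair i0 j0.
have pij : packable [:: i; j] (4 * D.+1).
  apply: packable2 => //; rewrite ?turn ?ifall ?jr ?orbT //.
  by move: ifall jr; rewrite /falls /rises; case: (f i); case: (f j).
apply: (packable_sub _ _ (packable_cat pij (IH t sfs trt))).
  by move=> k; rewrite !inE !mem_cat !inE; do !case: (_ == _); rewrite ?orbT.
rewrite !big_cons !big_cat big_cons /= /cost; lia.
Qed.

Lemma packable_links (s : seq nat) :
  {in s, forall j, f j != f j.+1 -> 0 < (runs j).2} ->
  packable s (\sum_(j <- s) cost j +
    6 * (count falls s - count rises s + (count rises s - count falls s)) + 8).
Proof.
move=> s0; pose straight j := f j == f j.+1.
have pS : packable (filter straight s) (\sum_(j <- filter straight s) cost j + 4).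
  by apply: packable_straight => j; rewrite mem_filter => /andP[/eqP].
have pF : {in filter falls s, forall j, falls j && (0 < (runs j).2)}.
  move=> j; rewrite mem_filter => /andP[jf js]; rewrite jf s0 //.
  by move: jf; rewrite /falls; case: (f j); case: (f _).
have pR : {in filter rises s, forall j, rises j && (0 < (runs j).2)}.
  move=> j; rewrite mem_filter => /andP[jr js]; rewrite jr s0 //.
  by move: jr; rewrite /rises; case: (f j); case: (f _).
have {pF pR} pT := packable_turns pF pR.
apply: (packable_sub _ _ (packable_cat pS pT)).
  move=> j js; rewrite !mem_cat !mem_filter js !andbT /straight /falls /rises.
  by case: (f j); case: (f _).
rewrite !size_filter big_cat /= !big_filter.
suff -> : \sum_(j <- s) cost j = (\sum_(j <- s | straight j) cost j +
    (\sum_(j <- s | falls j) cost j + \sum_(j <- s | rises j) cost j))%N by lia.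
rewrite (bigID straight) /=; congr addn; rewrite (bigID falls) /=.
congr addn; apply: eq_bigl => j; rewrite /straight /falls /rises;
  by case: (f j); case: (f _).
Qed.

(** The sign changes along a sequence alternate, so at most one of them stays
    unpaired. *)
Lemma falls_rises n :
  (count falls (iota 0 n) + f n = count rises (iota 0 n) + f 0)%N.
Proof.
elim: n => [|n IH] //; rewrite -[n.+1]addn1 iotaD !count_cat /= !addn0 add0n addn1.
by move: IH; rewrite /falls /rises; case: (f n); case: (f n.+1) => /=; lia.
Qed.

(** If link k is a power a^m, giving it a cycle of its own reduces its cost from
    about 2m to about m, which is what the term subtracted from the sum says.
    This saving is needed for a link that belongs to both halves of a word.
    Removing k from the sequence leaves at most two unpaired links. *)
Lemma packable_iota n k : k < n ->
  (forall j, j < n -> f j != f j.+1 -> 0 < (runs j).2) ->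
  packable (iota 0 n)
    (\sum_(j <- iota 0 n) cost j - (runs k).2 + 60).
Proof.
move=> kn n0; pose s : seq nat := rem k (iota 0 n).
have kI : k \in iota 0 n by rewrite mem_iota.
have pk : packable [:: k] ((runs k).2 + 40).
  have [fk|/(n0 k kn)/rotation_size_single[D [Dk Dle]]] := eqVneq (f k) (f k.+1).
    apply: (@packable_sub [:: k] _ (4 * 1)) => //; first lia.
    by apply: packable1; rewrite fk eqxx.
  have pk : packable [:: k] (4 * D.+1) by apply: packable1.
  exact: packable_sub pk.
have sI : {subset s <= iota 0 n} := @mem_rem _ _ _.
have ps : {in s, forall j, f j != f j.+1 -> 0 < (runs j).2}.
  by move=> j /sI; rewrite mem_iota => /n0.
have {}ps := packable_links ps.
have perm_s := perm_to_rem kI.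
apply: (packable_sub _ _ (packable_cat pk ps)).
  by move=> j; rewrite (perm_mem perm_s).
have := falls_rises n; rewrite !(seq.permP perm_s) (perm_big _ perm_s) big_cons /=.
have kE : cost k = (2 * (runs k).2 + 4)%N by [].
have fr : (falls k + rises k <= 1)%N by rewrite /falls /rises; case: (f k); case: (f _).
by rewrite -/s; case: (f 0); case: (f n) => /=; lia.
Qed.

End Packing.

(** * Words cut at the letters b *)

(** A letter b, inverted if the Boolean holds, followed by a power of a. *)
Definition block : Type := (bool * (bool * nat))%type.

Definition block_word (c : block) : seq letter :=
  (true, c.1) :: nseq c.2.2 (false, c.2.1).

Definition blocks_word (cs : seq block) : seq letter :=
  flatten (map block_word cs).

Definition reduced_blocks : pred (seq block) :=
  sorted (fun c d : block => (c.2.2 == 0%N) ==> (c.1 == d.1)).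

Lemma reduced_blocksP w : reduced w -> exists r cs,
  w = nseq r.2 (false, r.1) ++ blocks_word cs /\ reduced_blocks cs.
Proof.
elim: w => [|l w IH] rw; first by exists (false, 0%N), [::].
have [[e n] [cs [wE rcs]]] := IH (reduced_behead rw).
case: l rw => -[] x; rewrite reduced_cons wE => /andP[lw _] /=.
  exists (false, 0%N), ((x, (e, n)) :: cs); split=> //.
  rewrite /reduced_blocks /=; case: cs rcs {wE} lw => //= d cs.
  rewrite /reduced_blocks /= => -> lw; rewrite andbT; apply/implyP => /= n0.
  by move: lw; rewrite (eqP n0) /= /inv_letter /=; case: (d.1); case: x.
case: n lw {wE} => [|n] /= lw; first by exists (x, 1%N), cs.
have -> : x = e by move: lw; rewrite /inv_letter /=; case: x; case: e.
by exists (e, n.+2), cs.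
Qed.

Lemma count_blocks_word cs :
  (count (fun l : letter => l.1) (blocks_word cs) = size cs) *
  (count (fun l : letter => ~~ l.1) (blocks_word cs) =
   sumn [seq c.2.2 | c <- cs]).
Proof.
rewrite /blocks_word; elim: cs => //= c cs [IH1 IH2].
by rewrite !count_cat !count_nseq IH1 IH2 /= mul0n mul1n.
Qed.

Lemma tails_blocks (V : finType) (a b : {perm V}) (c0 : block) cs
    (P Q : nat -> V) :
  (forall j, j < size cs -> step a b (true, (nth c0 cs j).1) (P j) = Q j) ->
  (forall j, j.+1 < size cs -> run a (nth c0 cs j).2 (Q j) = P j.+1) ->
  tails a b (P 0%N) (blocks_word cs) =
  mkseq (fun j => if (nth c0 cs j).1 then Q j else P j) (size cs).
Proof.
have mkseqS (g : nat -> V) n : mkseq g n.+1 = g 0%N :: mkseq (g \o S) n.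
  by rewrite /mkseq -[n.+1]add1n iotaD map_cat /= (iotaDl 1 0) -map_comp.
elim: cs P Q => [|c cs IH] P Q PQ QP //.
rewrite -[size (c :: cs)]/(size cs).+1 mkseqS /=.
rewrite (PQ 0%N) //= tails_cat tails_run /= walk_run -surjective_pairing.
congr cons; case: cs IH PQ QP => // d cs IH PQ QP.
rewrite (QP 0%N) // (IH (P \o S) (Q \o S)) //.
- by move=> j js; apply: (PQ j.+1).
- by move=> j js; apply: (QP j.+1).
Qed.

(** The links of the segment are the powers of a between its b-letters, hence all
    but the last power. Two trivial links are added, one at each end, so that
    every b-letter lies between two links; the signs are prolonged
    constantly, which makes these links straight. *)
Lemma segment_distinct_edges cs k : reduced_blocks cs -> k < size cs ->
  let lens := [seq c.2.2 | c <- take (size cs).-1 cs] in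
  exists (V : finType) (a b : {perm V}) p,
    uniq (tails a b p (blocks_word cs)) /\
    4 * #|V| + nth 0%N lens k <= 2 * sumn lens + 4 * size cs + 64.
Proof.
case: cs => // c0 cs0; set cs := c0 :: cs0 => rcs kcs lens.
set h := (size cs).-1; have csh : size cs = h.+1 by [].
pose eps j := (nth c0 cs j).1.
(* Sign of the letter before link j; letter j itself lies between the links
   j and j.+1. *)
pose f j := if j is i.+1 then eps (minn i h) else eps 0%N.
pose runs := nth (false, 0%N) ((false, 0%N) :: [seq c.2 | c <- take h cs]).
have runsE j : j < h -> runs j.+1 = (nth c0 cs j).2.
  by move=> jh; rewrite /runs /= (nth_map c0) ?nth_take // size_take csh ltnS leqnn.
have lensE j : (runs j.+1).2 = nth 0%N lens j.
  rewrite /runs /lens /= -/cs -/h (map_comp snd snd).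
  have [jh|jh] := ltnP j (size [seq c.2 | c <- take h cs]).
    by rewrite (nth_map (false, 0%N)).
  by rewrite !nth_default // size_map.
have turn j : j < h.+2 -> f j != f j.+1 -> 0 < (runs j).2.
  rewrite /f; case: j => [|j] jh; first by rewrite min0n eqxx.
  have [jh'|jh'] := ltnP j h; last first.
    by rewrite (minn_idPr (leqW jh')) eqxx.
  rewrite runsE // (minn_idPl jh') lt0n.
  apply: contraNN => n0; move: rcs => /(sortedP c0)/(_ j).
  by rewrite csh ltnS jh' n0 => /(_ isT).
have kh : k.+1 < h.+2 by rewrite ltnS -csh.
have [V [a [u [pu Vc]]]] := packable_iota kh turn.
pose P j := run a (runs j) (u j); pose Q j := u j.+1.
pose src j := if eps j then Q j else P j.
pose dst j := if eps j then P j else Q j.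
pose src_slot j := if eps j then (j.+1, false) else (j, true).
pose dst_slot j := if eps j then (j, true) else (j.+1, false).
have srcE j : j < h.+1 -> (src j, true) = slot runs f a u (src_slot j).1 (src_slot j).2.
  move=> jh; rewrite /src /src_slot /slot /= -ltnS in jh *.
  by case ej: (eps j) => //=; rewrite (minn_idPl _) ?ej //.
have dstE j : j < h.+1 -> (dst j, false) = slot runs f a u (dst_slot j).1 (dst_slot j).2.
  move=> jh; rewrite /dst /dst_slot /slot /= -ltnS in jh *.
  by case ej: (eps j) => //=; rewrite (minn_idPl _) ?ej //.
have src_inj : {in iota 0 h.+1 &, injective src}.
  move=> i j; rewrite !mem_iota /= => ih jh ij.
  have : src_slot i = src_slot j.
    rewrite [LHS]surjective_pairing [RHS]surjective_pairing.
    apply: pu; rewrite -?srcE // ?ij // mem_iota /src_slot; case: ifP => _ /=; lia.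
  by rewrite /src_slot; case: (eps i); case: (eps j) => -[].
have dst_inj : {in iota 0 h.+1 &, injective dst}.
  move=> i j; rewrite !mem_iota /= => ih jh ij.
  have : dst_slot i = dst_slot j.
    rewrite [LHS]surjective_pairing [RHS]surjective_pairing.
    apply: pu; rewrite -?dstE // ?ij // mem_iota /dst_slot; case: ifP => _ /=; lia.
  by rewrite /dst_slot; case: (eps i); case: (eps j) => -[].
(* Distinct slots make the prescribed b-edges a partial injection. *)
pose E := [seq (src j, dst j) | j <- iota 0 h.+1].
have [||b bE] := @extend_partial_injection V E.
- by rewrite /unzip1 -map_comp map_inj_in_uniq ?iota_uniq.
- by rewrite /unzip2 -map_comp map_inj_in_uniq ?iota_uniq.
exists V, a, b, (P 0%N); split.
  rewrite (tails_blocks (c0 := c0) (P := P) (Q := Q)).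
  - by rewrite /mkseq map_inj_in_uniq ?iota_uniq // csh.
  - move=> j; rewrite csh => jh; have : b (src j) = dst j.
      by apply: (bE (src j, dst j)); apply: map_f; rewrite mem_iota.
    rewrite /src /dst /step /eval_letter /= -/(eps j); case: (eps j) => // <-.
    by rewrite permK.
  - by move=> j; rewrite csh ltnS => jh; rewrite /P /Q runsE.
have costE : \sum_(j <- iota 0 h.+2) cost runs j = (2 * sumn lens + 4 * h.+2)%N.
  pose l := 0%N :: rcons lens 0.
  have lE j : cost runs j = (2 * nth 0%N l j + 4)%N.
    rewrite /cost; case: j => [|j]; first by [].
    rewrite lensE /l /= nth_rcons; case: ltngtP => // jl; first by rewrite nth_default // ltnW.
    by rewrite nth_default // jl.
  have szl : size l = h.+2 by rewrite /= size_rcons size_map size_take csh leqnn.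
  have suml : sumn l = sumn lens by rewrite /= sumn_rcons addn0.
  rewrite -szl -suml (eq_bigr _ (fun j _ => lE j)).
  transitivity (\sum_(x <- l) (2 * x + 4))%N; first by rewrite [RHS](big_nth 0%N) /index_iota subn0.
  by elim: l {lE szl suml} => [|x l IH]; rewrite ?big_nil // big_cons IH /=; lia.
have le_sumn l i : nth 0%N l i <= sumn l.
  by elim: l i => [|x l IH] [|i] //=; [exact: leq_addr | exact: leq_trans (IH i) (leq_addl _ _)].
by move: Vc (le_sumn lens k); rewrite costE lensE csh; lia.
Qed.

(** The segment traverses as many distinct b-edges as it has b-letters, which is
    more than half of the b-letters of w: one of these edges is traversed
    exactly once. *)
Lemma nontrivial_of_segment w x cs y k : w = x ++ blocks_word cs ++ y ->
  reduced_blocks cs -> k < size cs -> count (fun l : letter => l.1) w < 2 * size cs ->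
  exists (V : finType) (a b : {perm V}), ev a b w <> 1 /\
    4 * #|V| + nth 0%N [seq c.2.2 | c <- take (size cs).-1 cs] k <=
    2 * sumn [seq c.2.2 | c <- take (size cs).-1 cs] + 4 * size cs + 68.
Proof.
move=> wE rcs kcs few.
have [V [a [b [p [up Vle]]]]] := segment_distinct_edges rcs kcs.
pose q := (ev a b x : {perm V})^-1 p.
have xq : walk a b x q = p by rewrite walkE permKV.
have [||e /nontrivial_of_single_edge[W [a' [b' [WV w1]]]]] :=
    count_mem1_exists (s := tails a b q w) up.
- by move=> e ein; rewrite wE !tails_cat xq !mem_cat ein orbT.
- by rewrite !size_tails count_blocks_word -mul2n.
by exists W, a', b'; split=> //; lia.
Qed.

(** * Both halves of a word *)

(** The points needed for the first half and for the second half of w are added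
    up, and the cheaper half is used; b is the letter that occurs less often,
    which is what brings the resulting bound (2B + A)/4 below 2(A + B)/5. *)
Lemma nontrivial_action w : reduced w -> w != [::] ->
  exists (V : finType) (a b : {perm V}),
    ev a b w <> 1 /\ 5 * #|V| <= 2 * size w + 200.
Proof.
wlog few : w / count (fun l : letter => l.1) w <= count (fun l : letter => ~~ l.1) w.
  move=> wl rw w0; have [/wl|/ltnW few] := leqP (count (fun l => l.1) w) (count (fun l => ~~ l.1) w).
    exact.
  have [|||V [a [b [w1 Vle]]]] := wl (map swap_letter w).
  - rewrite !count_map (eq_count (a2 := fun l : letter => ~~ l.1)) //.
    by rewrite [leqRHS](eq_count (a2 := fun l : letter => l.1)) // => l /=; rewrite negbK.
  - rewrite /reduced sorted_map; apply: sub_sorted rw => -[l e] [m g] /=.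
    by rewrite /swap_letter /inv_letter /= !xpair_eqE; case: l; case: m.
  - by rewrite -size_eq0 size_map size_eq0.
  by exists V, b, a; rewrite -ev_swap -(size_map swap_letter w).
move=> rw w0; have [[e n] [bs [wE rbs]]] := reduced_blocksP rw.
have [cB cA] : count (fun l : letter => l.1) w = size bs /\
    count (fun l : letter => ~~ l.1) w = (n + sumn [seq c.2.2 | c <- bs])%N.
  by rewrite wE !count_cat !count_nseq !count_blocks_word /= mul0n mul1n.
have szw : size w = (size bs + (n + sumn [seq c.2.2 | c <- bs]))%N.
  by rewrite -cB -cA count_predC.
rewrite cB cA in few.
have [bs0|bs0] := posnP (size bs).
  move: bs0 wE => /size0nil -> /=; rewrite cats0 => wE.
  have n0 : 0 < n by case: n wE {few cA szw} w0 => // -> .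
  have [D [Dn Dle]] := rotation_size_single n0.
  exists 'I_D.+1, (rotation D), (rotation D); split; last first.
    by rewrite card_ord wE size_nseq; lia.
  move/ev_walk1 => /(_ ord0)/eqP; rewrite wE walk_run run_rotation_fix.
  exact/negP.
pose h := (size bs)./2; have hB : h < size bs by rewrite /h; lia.
have few_take m : h < m -> size bs < 2 * m by rewrite /h; lia.
pose lens := [seq c.2.2 | c <- bs].
pose t := (size bs - h.+1)%N.
have [||||V1 [a1 [b1 [w1 V1le]]]] := @nontrivial_of_segment w
    (nseq n (false, e)) (take h.+1 bs) (blocks_word (drop h.+1 bs)) h.-1.
- by rewrite wE -flatten_cat -map_cat cat_take_drop.
- exact: take_sorted.
- by rewrite size_takel //; lia.
- by rewrite cB size_takel // few_take.
have [||||V2 [a2 [b2 [w2 V2le]]]] := @nontrivial_of_segment w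
    (nseq n (false, e) ++ blocks_word (take t bs)) (drop t bs) [::] 0.
- by rewrite wE cats0 -catA -flatten_cat -map_cat cat_take_drop.
- exact: drop_sorted.
- by rewrite size_drop /t; lia.
- by rewrite cB size_drop few_take // /t; lia.
have szt : size (take h.+1 bs) = h.+1 by rewrite size_takel.
have szd : size (drop t bs) = h.+1 by rewrite size_drop /t; lia.
rewrite szt szd !map_take map_drop take_takel // -/lens /= in V1le V2le.
have sumn_drop_take i (l : seq nat) : (sumn (take i l) + sumn (drop i l))%N = sumn l.
  by rewrite -sumn_cat cat_take_drop.
have szl : size lens = size bs by rewrite size_map.
(* The two segments share at most the link for which both bounds have their
   saving: the last link of the first and the first link of the second. *)
have overlap : 2 * (sumn (take h lens) + sumn (take h (drop t lens))) <=
    2 * sumn lens + nth 0%N (take h lens) h.-1 + nth 0%N (take h (drop t lens)) 0.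
  have := sumn_drop_take h lens; have := sumn_drop_take h (drop t lens).
  have := odd_double_half (size bs); rewrite -/h; case: (odd _) => /= hE.
    have tE : t = h by rewrite /t; lia.
    by rewrite tE => H1 H2; have := sumn_drop_take h (drop h lens); lia.
  have h0 : 0 < h by lia.
  have tE : t = h.-1 by rewrite /t; lia.
  have hl : h.-1 < size lens by rewrite szl; lia.
  rewrite tE (drop_nth 0%N hl) prednK // !nth_take ?prednK //=.
  rewrite -[in take h (_ :: _)](prednK h0) /=.
  have := sumn_drop_take h.-1 (drop h lens); lia.
have hle : 2 * h <= size bs by rewrite /h; lia.
have arith v1 v2 s1 s2 l m1 m2 : v1 <= v2 ->
    4 * v1 + m1 <= 2 * s1 + 4 * h.+1 + 68 ->
    4 * v2 + m2 <= 2 * s2 + 4 * h.+1 + 68 ->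
    2 * (s1 + s2) <= 2 * l + m1 + m2 -> size bs <= n + l ->
    5 * v1 <= 2 * (size bs + (n + l)) + 200.
  by move: hle; clearbody h; clear; lia.
rewrite szw; have [V12|/ltnW V21] := leqP #|V1| #|V2|.
  by exists V1, a1, b1; split=> //; apply: arith V12 V1le V2le overlap few.
exists V2, a2, b2; split=> //; apply: arith V21 V2le V1le _ few.
by rewrite addnC addnAC.
Qed.

(** * Divisibility index and laws *)

Lemma nontrivial_in_Sn (V : finType) (a b : {perm V}) s n :
  #|V| <= n -> ev a b s <> 1 -> exists g h : 'S_n, ev g h s <> 1.
Proof.
move=> Vn s1; pose f (v : V) : 'I_n := widen_ord Vn (enum_rank v).
have f_inj : injective f by move=> v v' /(congr1 val)/= /val_inj/enum_rank_inj.
have lift (c : {perm V}) : exists c' : 'S_n, forall v, c' (f v) = f (c v).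
  have [||c' c'E] := @extend_partial_injection _ [seq (f v, f (c v)) | v <- enum V].
  - by rewrite /unzip1 -map_comp map_inj_uniq ?enum_uniq.
  - rewrite /unzip2 -map_comp map_inj_uniq ?enum_uniq //.
    by move=> v v' /f_inj/perm_inj.
  by exists c' => v; apply: (c'E (f v, f (c v))); apply: map_f; rewrite mem_enum.
have [a' a'E] := lift a; have [b' b'E] := lift b; exists a', b' => s1'.
apply: s1; apply/ev_walk1 => v; apply: f_inj.
by rewrite -(walk_intertwine a'E b'E) walkE s1' perm1.
Qed.

Local Open Scope classical_set_scope.
Local Open Scope card_scope.

(** The stabilizer of a moved point p. Paths compose on the right, so the left
    coset x H is determined by the image of p under the inverse of x. *)
Lemma separating_index_le (V : finType) (a b : {perm V}) (w : F2) :
  eval a b w <> 1 -> exists n, n <= #|V| /\ separating_indices w n.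
Proof.
move=> w1; have [p wp] : exists p, (eval a b w : {perm V}) p <> p.
  by apply: contrapT => np; apply: w1; apply/permP => p; rewrite perm1;
    apply: contrapT => wp; apply: np; exists p.
pose ac (x : F2) : V := (eval a b x : {perm V}) p.
pose H : set F2 := [set x | ac x = p].
have H1 : group_closed [in H].
  split=> [|x y]; rewrite !in_setE; first by rewrite /H /= /ac eval1 perm1.
  rewrite /H /= /ac evalM evalV permM => -> yp.
  by rewrite -{1}yp permK.
pose coset (i : 'I_#|V|) : set F2 := [set x | ac (x^-1) = enum_val i].
have cosets : left_cosets H `<=` coset @` setT.
  move=> _ [x _ <-]; exists (enum_rank (ac x^-1)) => //.
  rewrite /coset enum_rankK; apply/seteqP; split=> y /=.
    move=> yx; exists (x^-1 * y); last by rewrite mulgA mulgV mul1g.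
    by rewrite /H /= /ac evalM permM -/(ac x^-1) -yx /ac -permM -evalM mulVg eval1 perm1.
  move=> [z zH <-]; rewrite /= /ac invMg evalM permM; congr ((_ : {perm V}) _).
  by rewrite evalV -{1}zH permK.
have [n Hn] := sub_finite_set cosets (finite_image _ finite_finset).
exists n; split; last by exists H.
rewrite -card_le_II (card_le_eqr card_II) -(card_le_eql Hn).
exact: card_le_trans (subset_card_le cosets) (card_image_le _ _).
Qed.

Local Close Scope classical_set_scope.
Local Close Scope card_scope.

Lemma divisibility_index_bound (w : F2) (w1 : w <> 1) :
  5 * divisibility_index w1 <= 2 * word_length w + 200.
Proof.
have w0 : word w != [::].
  by apply: contra_notN w1 => /eqP w0; apply: val_inj.
have [V [a [b [wV Vle]]]] := nontrivial_action (word_reduced w) w0.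
have [n [nV wn]] := separating_index_le (w := w) wV.
have [_ /(_ n wn)] := nat_minP (separating_indices_nonempty w1).
rewrite -/(divisibility_index w1) => Dn.
by apply: leq_trans Vle; rewrite leq_mul2l (leq_trans Dn nV).
Qed.

Lemma law_length_bound n : 5 * n <= 2 * alpha n + 200.
Proof.
have [[w [w1 law] wE] _] := nat_minP (law_lengths_nonempty n).
rewrite -/(alpha n) in wE.
have w0 : word w != [::].
  by apply: contra_notN w1 => /eqP w0; apply: val_inj.
have [V [a [b [wV Vle]]]] := nontrivial_action (word_reduced w) w0.
rewrite -/(word_length w) in Vle; rewrite leqNgt; apply/negP => short.
have Vn : #|V| <= n by lia.
by have [g [h]] := nontrivial_in_Sn Vn wV; apply; apply: law.
Qed.

Import GRing.Theory Num.Theory.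
Local Close Scope group_scope.
Local Open Scope ring_scope.

Theorem theorem1p1 (R : realType) :
  (exists K : R, forall (w : F2) (w1 : w <> 1%g),
     (divisibility_index w1)%:R <= 2 / 5 * (word_length w)%:R + K) /\
  (exists K' : R, forall n : nat, (0 < n)%N ->
     (alpha n)%:R >= 5 / 2 * n%:R - K').
Proof.
split; [exists 40 => w w1 | exists 100 => n _].
  have := divisibility_index_bound w1; rewrite -(ler_nat R) natrD !natrM; lra.
have := law_length_bound n; rewrite -(ler_nat R) natrD !natrM; lra.
Qed.
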